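(* Let $0\le a<b$ and let $f:[a,b]\to\mathbb{R}$, $[a,b]\subset[0,\infty)$, be a differentiable function on $(a,b)$ such that $f'\in L[a,b]$. Let $q\ge1$. Suppose that $|f'|^q$ is $s$-convex in the second sense on $[a,b]$ for some fixed $s\in(0,1]$, and that $|f'(x)|\le M$ for all $x\in[a,b]$. Then for every $\alpha>0$ and every $x\in[a,b]$, $$\left|\left(\frac{(x-a)^{\alpha}+(b-x)^{\alpha}}{b-a}\right)f(x)-\frac{\Gamma(\alpha+1)}{b-a}\left[J_{x-}^{\alpha}f(a)+J_{x+}^{\alpha}f(b)\right]\right|$$ $$\le \frac{M}{(1+p\alpha)^{\frac1p}}\left(\frac{2}{s+1}\right)^{\frac1q}\left[\frac{(x-a)^{\alpha+1}+(b-x)^{\alpha+1}}{b-a}\right],$$ where $p$ is the exponent conjugate to $q$, $\frac1p+\frac1q=1$.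
   Context: $L[a,b]$ denotes the space of Lebesgue integrable functions on $[a,b]$. A function $g$ is $s$-convex in the second sense on $[a,b]\subset[0,\infty)$, where $s\in(0,1]$, if $g(\lambda u+(1-\lambda)v)\le\lambda^s g(u)+(1-\lambda)^s g(v)$ for all $u,v\in[a,b]$ and $\lambda\in[0,1]$. The hypotheses on $|f'|$ over the closed interval $[a,b]$ presuppose that $f'$ is defined at the endpoints, as the one-sided derivatives $f'(a)$ and $f'(b)$. When $q=1$, so that $p=\infty$, the factor $(1+p\alpha)^{1/p}$ is read as its limit $1$. $\Gamma(\alpha)=\int_0^\infty e^{-u}u^{\alpha-1}du$ is the Euler Gamma function. The Riemann-Liouville fractional integrals of order $\alpha>0$ appearing here are $J_{x-}^{\alpha}f(a)=\frac{1}{\Gamma(\alpha)}\int_a^x (t-a)^{\alpha-1}f(t)\,dt$ and $J_{x+}^{\alpha}f(b)=\frac{1}{\Gamma(\alpha)}\int_x^b (b-t)^{\alpha-1}f(t)\,dt$ (equal to $0$ when the interval of integration is degenerate). *)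

(* Defs.v *)
From HB Require Import structures.
From mathcomp Require Import all_boot all_order all_algebra.
From mathcomp Require Import all_classical all_reals all_analysis.
Set Implicit Arguments.
Unset Strict Implicit.
Unset Printing Implicit Defensive.
Import Order.TTheory GRing.Theory Num.Theory.
Import numFieldNormedType.Exports.
Local Open Scope classical_set_scope.
Local Open Scope ring_scope.

(* A function on [a, b] is represented by a total function R -> R of which only
   the values on [a, b] matter; f' is its derivative there, one-sided at the
   endpoints. *)
Definition is_derivative_on (R : realType) (a b : R) (f f' : R -> R) : Prop :=
  [/\ forall x, x \in `]a, b[ -> is_derive x 1 f (f' x),
      h^-1 * (f (a + h) - f a) @[h --> 0^'+] --> f' a &
      h^-1 * (f (b + h) - f b) @[h --> 0^'-] --> f' b].

Definition s_convex (R : realType) (s : R) (D : set R) (g : R -> R) : Prop :=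
  forall u v l : R, D u -> D v -> 0 <= l <= 1 ->
    g (l * u + (1 - l) * v) <= l `^ s * g u + (1 - l) `^ s * g v.

Definition Gamma (R : realType) (alpha : R) : R :=
  Rintegral (@lebesgue_measure R) `]0, +oo[
    (fun u => expR (- u) * u `^ (alpha - 1)).

(* J_{x-}^alpha f(y) for y <= x. *)
Definition RL_minus (R : realType) (alpha x : R) (f : R -> R) (y : R) : R :=
  (Gamma alpha)^-1 *
  Rintegral (@lebesgue_measure R) `[y, x]
    (fun t => (t - y) `^ (alpha - 1) * f t).

(* J_{x+}^alpha f(y) for x <= y. *)
Definition RL_plus (R : realType) (alpha x : R) (f : R -> R) (y : R) : R :=
  (Gamma alpha)^-1 *
  Rintegral (@lebesgue_measure R) `[x, y]
    (fun t => (y - t) `^ (alpha - 1) * f t).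

(* (1 + p alpha)^(1/p), read as its limit 1 at p = +oo; the value at p = -oo is
   irrelevant, since an exponent conjugate to some q >= 1 is never -oo. *)
Definition conj_factor (R : realType) (p : \bar R) (alpha : R) : R :=
  if p is r%:E then (1 + r * alpha) `^ r^-1 else 1.

(* Main.v *)
Require Import Defs.
From HB Require Import structures.
From mathcomp Require Import all_boot all_order all_algebra.
From mathcomp Require Import all_classical all_reals all_analysis.
From mathcomp Require Import measurable_realfun ring lra.
Import Order.TTheory GRing.Theory Num.Theory.
Import numFieldNormedType.Exports.
Local Open Scope classical_set_scope.
Local Open Scope ring_scope.

(** The two halves of the left-hand side are treated alike. By the functional
    equation of Gamma, and because Gamma alpha is neither zero nor infinite,
    Gamma (alpha + 1) turns the two fractional integrals into alpha times plain
    integrals, and (x - a)^alpha is alpha times the integral over [a, x] of the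
    kernel (t - a)^(alpha - 1). The half over [a, x] is therefore
      alpha * \int_a^x (t - a)^(alpha - 1) * (f x - f t) dt,
    where |f x - f t| <= M * (x - t) by the mean value theorem. Since
    x - t = (x - a) - (t - a), the resulting bound is a combination of two
    moments of the kernel and equals M * (x - a)^(alpha + 1) / (alpha + 1)
    ([power_kernel_deviation]). The half over [x, b] is its mirror image.

    The constant 1 / (alpha + 1) lies below the asserted one: Young's
    inequality for the conjugate exponents p and q gives Bernoulli's inequality
    1 + p * alpha <= (1 + alpha)^p, that is (1 + p * alpha)^(1/p) <= 1 + alpha
    ([conj_factor_gt0_le]), while 2 / (s + 1) >= 1 makes the remaining factor
    at least 1 ([convexity_factor_ge1]).

    For alpha < 1 the kernels are unbounded at an endpoint, and the Gamma
    integral is improper at 0 and at infinity. Both are reached from compact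
    intervals increasing to the domain, where the fundamental theorem of
    calculus holds for continuous integrands and monotone convergence gives the
    limit ([ge0_improper_FTC]). *)

(** * Improper integrals over an increasing union of segments *)

Section ImproperIntegral.
Context {R : realType}.
Notation mu := (@lebesgue_measure R).
Variables (D : set R) (u v : nat -> R).
Hypotheses (udec : nonincreasing_seq u) (vinc : nondecreasing_seq v).
Hypothesis ltuv : forall n, u n < v n.
Hypothesis exhD : \bigcup_n `[u n, v n]%classic = D.

Lemma sub_exhaustion n t : t \in `[u n, v n] -> D t.
Proof. by move=> tn; rewrite -exhD; exists n. Qed.

Lemma continuous_exhaustion n (g : R -> R) : (forall t, D t -> {for t, continuous g}) ->
  {within `[u n, v n], continuous g}.
Proof.
move=> cg; apply: continuous_in_subspaceT => t.
by rewrite inE => /sub_exhaustion; exact: cg.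
Qed.

(** Continuity at each point of D is enough for measurability because D is a
    countable union of segments; D itself may be any kind of interval. *)
Lemma measurable_fun_exhaustion (g : R -> R) :
  (forall t, D t -> {for t, continuous g}) -> measurable_fun D g.
Proof.
move=> cg; rewrite -exhD; apply/measurable_fun_bigcup => // n.
by apply: subspace_continuous_measurable_fun => //; exact: continuous_exhaustion.
Qed.

Lemma cvg_integral_exhaustion (g : R -> R) :
  (forall t, D t -> {for t, continuous g}) -> (forall t, D t -> 0 <= g t) ->
  (\int[mu]_(t in `[u n, v n]) (g t)%:E @[n --> \oo]
     --> \int[mu]_(t in D) (g t)%:E)%E.
Proof.
move=> cg g0; rewrite -exhD; apply: ge0_nondecreasing_set_cvg_integral => //.
- move=> m n mn; rewrite subsetEset; apply: subset_itv; rewrite bnd_simp.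
  + exact: udec.
  + exact: vinc.
- move=> n; apply/measurable_EFinP.
  have /measurable_fun_bigcup : measurable_fun (\bigcup_n `[u n, v n]%classic) g.
    by rewrite exhD; exact: measurable_fun_exhaustion.
  exact.
- by move=> n t tn; rewrite lee_fin; exact/g0/(sub_exhaustion n).
Qed.

Lemma integral_exhaustion_FTC n (F g : R -> R) :
  (forall t, D t -> is_derive t 1 F (g t)) -> (forall t, D t -> {for t, continuous g}) ->
  (\int[mu]_(t in `[u n, v n]) (g t)%:E = (F (v n) - F (u n))%:E)%E.
Proof.
move=> dF cg; rewrite (continuous_FTC2 (ltuv n) (F := F)) //.
- exact: continuous_exhaustion.
- have cF : {within `[u n, v n], continuous F}.
    apply: derivable_within_continuous => t /sub_exhaustion Dt.
    exact: (@ex_derive _ _ _ _ _ _ _ (dF _ Dt)).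
  have [_ cu cv] := (continuous_within_itvP F (ltuv n)).1 cF.
  split=> // t tn; have Dt : D t by exact: (@sub_exhaustion n t (subset_itv_oo_cc tn)).
  exact: (@ex_derive _ _ _ _ _ _ _ (dF _ Dt)).
- move=> t tn; have Dt : D t by exact: (@sub_exhaustion n t (subset_itv_oo_cc tn)).
  by rewrite derive1E; apply: (@derive_val _ _ _ _ _ _ _ (dF _ Dt)).
Qed.

(** The identity holds in the extended reals, by monotone convergence, so that
    the finiteness of the limits l and L of the primitive can serve to prove g
    integrable. *)
Lemma ge0_improper_FTC (F g : R -> R) (l L : R) :
  (forall t, D t -> 0 <= g t) ->
  (forall t, D t -> is_derive t 1 F (g t)) -> (forall t, D t -> {for t, continuous g}) ->
  F (u n) @[n --> \oo] --> l -> F (v n) @[n --> \oo] --> L ->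
  (\int[mu]_(t in D) (g t)%:E = (L - l)%:E)%E.
Proof.
move=> g0 dF cg Fu Fv; have := cvg_integral_exhaustion g cg g0.
under eq_cvg do rewrite (integral_exhaustion_FTC _ _ _ dF cg).
move=> h; apply: (cvg_unique _ h) => //.
by apply: cvg_EFin; [exact: nearW | exact: cvgB].
Qed.

Lemma integrable_exhaustion (g : R -> R) :
  (forall t, D t -> {for t, continuous g}) -> (forall t, D t -> 0 <= g t) ->
  (\int[mu]_(t in D) (g t)%:E < +oo)%E -> mu.-integrable D (EFin \o g).
Proof.
move=> cg g0 gfin; apply/integrableP; split.
  by apply/measurable_EFinP; exact: measurable_fun_exhaustion.
suff -> : (\int[mu]_(t in D) `|(EFin \o g) t| = \int[mu]_(t in D) (g t)%:E)%E by [].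
by apply: eq_integral => t /[!inE] Dt; rewrite /= ger0_norm// g0.
Qed.

End ImproperIntegral.

(** * A fundamental theorem of calculus for integrands unbounded at the endpoints *)

Section ClosedInterval.
Context {R : realType}.
Notation mu := (@lebesgue_measure R).

Lemma is_derive_continuous (F : R -> R) (x l : R) :
  is_derive x 1 F l -> {for x, continuous F}.
Proof. by move=> dF; apply/differentiable_continuous/derivable1_diffP/ex_derive. Qed.

Lemma harmonic_nonincreasing : nonincreasing_seq (@harmonic R).
Proof. by move=> m n mn; rewrite /harmonic lef_pV2 ?posrE ?ltr0n// ler_nat. Qed.

(** The shift by 2 in the index makes the margin at most a third of the length,
    so that every segment of the union is nondegenerate. *)
Lemma bigcup_itvcc_oo (c d : R) : c < d ->
  \bigcup_n `[c + (d - c) * harmonic n.+2, d - (d - c) * harmonic n.+2]%classic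
    = `]c, d[%classic.
Proof.
move=> cd; have dc0 : 0 < d - c by rewrite subr_gt0.
have e0 : (d - c) * harmonic n @[n --> \oo] --> (0 : R).
  by rewrite -[X in _ --> X](mulr0 (d - c)); apply: cvgM; [exact: cvg_cst|exact: cvg_harmonic].
apply/seteqP; split=> t /=.
  move=> [n _] /=; rewrite !in_itv/= => /andP[ct td].
  have ep : 0 < (d - c) * harmonic n.+2 by rewrite mulr_gt0// invr_gt0 ltr0n.
  by rewrite (lt_le_trans _ ct) ?ltrDl// (le_lt_trans td)// ltrBlDr ltrDl.
rewrite in_itv/= => /andP[ct td].
have m0 : 0 < Num.min (t - c) (d - t) by rewrite lt_min !subr_gt0 ct.
have [n _ /(_ n.+2) hn] := cvgr_le _ e0 _ m0.
exists n => //=; have := hn (leq_trans (leqnSn n) (leqnSn n.+1)).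
by rewrite le_min in_itv/= !lerBrDl => /andP[-> h2]; rewrite addrC.
Qed.

(** Only F has to extend continuously to the endpoints, where g may blow up or
    take an arbitrary value. *)
Lemma ge0_FTC_closed (F g : R -> R) (c d : R) : c < d ->
  (forall t, t \in `]c, d[ -> 0 <= g t) ->
  (forall t, t \in `]c, d[ -> is_derive t 1 F (g t)) ->
  (forall t, t \in `]c, d[ -> {for t, continuous g}) ->
  F x @[x --> c^'+] --> F c -> F x @[x --> d^'-] --> F d ->
  mu.-integrable `[c, d] (EFin \o g) /\
  \int[mu]_(t in `[c, d]) g t = F d - F c.
Proof.
move=> cd g0 dF cg Fc Fd; have dc0 : 0 < d - c by rewrite subr_gt0.
pose e n := (d - c) * @harmonic R n.+2.
have e_gt0 n : 0 < e n by rewrite mulr_gt0// invr_gt0 ltr0n.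
have e_dec m n : (m <= n)%N -> e n <= e m.
  by move=> mn; rewrite ler_pM2l// harmonic_nonincreasing.
have e_cvg : e n @[n --> \oo] --> (0 : R).
  rewrite -[X in _ --> X](mulr0 (d - c)); apply: cvgM; first exact: cvg_cst.
  by have := @cvg_harmonic R; rewrite -2!cvg_shiftS.
pose u n := c + e n; pose v n := d - e n.
have udec : nonincreasing_seq u by move=> m n mn; rewrite lerD2l e_dec.
have vinc : nondecreasing_seq v by move=> m n mn; rewrite lerB// e_dec.
have ltuv n : u n < v n.
  have : e n <= (d - c) / 3 by exact: (e_dec 0%N).
  by rewrite /u /v; lra.
have exh := bigcup_itvcc_oo _ _ cd.
have cvu : F (u n) @[n --> \oo] --> F c.
  apply: ((cvg_at_rightP F c (F c)).1 Fc); split; first by move=> n; rewrite ltrDl.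
  by rewrite -[X in _ --> X]addr0; apply: cvgD => //; exact: cvg_cst.
have cvv : F (v n) @[n --> \oo] --> F d.
  apply: ((cvg_at_leftP F d (F d)).1 Fd); split.
    by move=> n; rewrite ltrBlDr ltrDl.
  by rewrite -[X in _ --> X]subr0; apply: cvgB => //; exact: cvg_cst.
have intE := ge0_improper_FTC _ _ _ udec vinc ltuv exh _ _ _ _ g0 dF cg cvu cvv.
have mg := measurable_fun_exhaustion _ _ _ exh _ cg.
have mgc : measurable_fun `[c, d] g by exact: measurable_fun_itv_cc mg.
have intcE : (\int[mu]_(t in `[c, d]) (g t)%:E = (F d - F c)%:E)%E.
  by rewrite -intE integral_itv_bndoo//; exact/measurable_EFinP.
split; last by rewrite /Rintegral intcE.
apply/integrableP; split; first exact/measurable_EFinP.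
rewrite integral_itv_bndoo; last first.
  by apply: measurableT_comp => //; exact/measurable_EFinP.
suff -> : (\int[mu]_(t in `]c, d[) `|(EFin \o g) t| = \int[mu]_(t in `]c, d[) (g t)%:E)%E.
  by rewrite intE ltry.
by apply: eq_integral => t /[!inE] Dt; rewrite /= ger0_norm// g0.
Qed.

End ClosedInterval.

(** * Moments of the Riemann-Liouville kernels *)

Section PowerKernels.
Context {R : realType}.
Notation mu := (@lebesgue_measure R).

Lemma integrable_set1 (c : R) (g : R -> \bar R) : mu.-integrable [set c] g.
Proof.
apply/integrableP; split; first exact: measurable_fun_set1.
by rewrite integral_set1.
Qed.

Lemma powR_continuous (k x : R) : 0 < x -> {for x, continuous (@powR R ^~ k)}.
Proof. by move=> x0; exact: is_derive_continuous _ _ _ (is_derive1_powR k x0). Qed.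

Lemma is_derive_powR_subl (k c t : R) : c < t ->
  is_derive t 1 (fun t => (t - c) `^ k) (k * (t - c) `^ (k - 1)).
Proof.
rewrite -subr_gt0 => ct.
have ds : is_derive t 1 ((fun t => t - c) : R -> R) 1.
  by apply: is_derive_eq; rewrite subr0.
have := @is_derive1_comp R (@powR R ^~ k) (fun t => t - c) t _ _
  (is_derive1_powR k ct) ds.
by rewrite mulr1.
Qed.

Lemma is_derive_powR_subr (k d t : R) : t < d ->
  is_derive t 1 (fun t => (d - t) `^ k) (- (k * (d - t) `^ (k - 1))).
Proof.
rewrite -subr_gt0 => td.
have ds : is_derive t 1 ((fun t => d - t) : R -> R) (- 1).
  by apply: is_derive_eq; rewrite add0r mul1r.
have := @is_derive1_comp R (@powR R ^~ k) (fun t => d - t) t _ _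
  (is_derive1_powR k td) ds.
by rewrite mulrN1.
Qed.

Lemma powR_left_moment (c d k : R) : c <= d -> 0 < k ->
  mu.-integrable `[c, d] (EFin \o (fun t => (t - c) `^ (k - 1))) /\
  \int[mu]_(t in `[c, d]) (t - c) `^ (k - 1) = (d - c) `^ k / k.
Proof.
move=> + k0; have kn0 : k != 0 by rewrite gt_eqF.
rewrite le_eqVlt => /predU1P[<-|cd].
  rewrite set_itv1 Rintegral_set1 subrr powR0 ?mul0r//; split => //.
  exact: integrable_set1.
pose F t : R := k^-1 * (t - c) `^ k.
have [|t|t|||] := @ge0_FTC_closed R F (fun t => (t - c) `^ (k - 1)) c d cd.
- by move=> t _; exact: powR_ge0.
- rewrite in_itv/= => /andP[ct _].
  apply: is_derive_eq; first exact: is_deriveZ (is_derive_powR_subl k _ _ ct).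
  by rewrite /GRing.scale/= mulKf.
- rewrite in_itv/= => /andP[ct _].
  exact: is_derive_continuous _ _ _ (is_derive_powR_subl _ _ _ ct).
- rewrite /F subrr powR0// -[X in _ --> X](_ : k^-1 * 0 = _)//; apply: cvgM; first exact: cvg_cst.
  apply/cvg_at_rightP => u [cu uc].
  apply: ((cvg_at_rightP _ _ _).1 (powR_cvg0 k0) (fun n => u n - c)); split.
    by move=> n; rewrite subr_gt0.
  by rewrite -(subrr c); apply: cvgB => //; exact: cvg_cst.
- apply: cvg_at_left_filter; apply: cvgM; first exact: cvg_cst.
  exact: is_derive_continuous _ _ _ (is_derive_powR_subl _ _ _ cd).
move=> ii ->; split=> //.
by rewrite /F subrr powR0// mulr0 subr0 mulrC.
Qed.

Lemma powR_right_moment (c d k : R) : c <= d -> 0 < k ->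
  mu.-integrable `[c, d] (EFin \o (fun t => (d - t) `^ (k - 1))) /\
  \int[mu]_(t in `[c, d]) (d - t) `^ (k - 1) = (d - c) `^ k / k.
Proof.
move=> + k0; have kn0 : k != 0 by rewrite gt_eqF.
rewrite le_eqVlt => /predU1P[<-|cd].
  rewrite set_itv1 Rintegral_set1 subrr powR0 ?mul0r//; split => //.
  exact: integrable_set1.
pose F t : R := - k^-1 * (d - t) `^ k.
have [|t|t|||] := @ge0_FTC_closed R F (fun t => (d - t) `^ (k - 1)) c d cd.
- by move=> t _; exact: powR_ge0.
- rewrite in_itv/= => /andP[_ td].
  apply: is_derive_eq; first exact: is_deriveZ (is_derive_powR_subr k _ _ td).
  by rewrite /GRing.scale/= mulrNN mulKf.
- rewrite in_itv/= => /andP[_ td].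
  exact: is_derive_continuous _ _ _ (is_derive_powR_subr _ _ _ td).
- apply: cvg_at_right_filter; apply: cvgM; first exact: cvg_cst.
  exact: is_derive_continuous _ _ _ (is_derive_powR_subr _ _ _ cd).
- rewrite /F subrr powR0// -[X in _ --> X](_ : - k^-1 * 0 = _)//; apply: cvgM; first exact: cvg_cst.
  apply/cvg_at_leftP => u [ud uc].
  apply: ((cvg_at_rightP _ _ _).1 (powR_cvg0 k0) (fun n => d - u n)); split.
    by move=> n; rewrite subr_gt0.
  by rewrite -(subrr d); apply: cvgB => //; exact: cvg_cst.
move=> ii ->; split=> //.
by rewrite /F subrr powR0// mulr0 sub0r mulNr opprK mulrC.
Qed.

End PowerKernels.

(** * The Gamma integral and its functional equation *)

Section GammaRecurrence.
Context {R : realType}.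
Notation mu := (@lebesgue_measure R).
Local Notation D := (`]0, +oo[%classic : set R).
Let u n : R := harmonic n.+1.
Let v n : R := n.+1%:R.

(** This is 1 + t <= m * exp (t / m), which follows from 1 + t/m <= exp (t / m)
    and m >= 1, raised to the power m. *)
Lemma powR_le_expR (m t : R) : 1 <= m -> 0 <= t -> (1 + t) `^ m <= m `^ m * expR t.
Proof.
move=> m1 t0; have m0 : 0 < m by lra.
have le1t : 1 + t <= m * expR (t / m).
  apply: (@le_trans _ _ (m * (1 + t / m))); last by rewrite ler_pM2l// expR_ge1Dx.
  by rewrite mulrDr mulr1 mulrCA divff ?gt_eqF// mulr1 lerD2r.
rewrite -[t in expR t](@divfK _ m) ?gt_eqF// expRM -powRM ?expR_ge0 ?(ltW m0)//.
by apply: ge0_ler_powR; rewrite ?nnegrE//; lra.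
Qed.

Let udec : nonincreasing_seq u.
Proof. by move=> m n mn; exact: harmonic_nonincreasing. Qed.

Let vinc : nondecreasing_seq v.
Proof. by move=> m n mn; rewrite ler_nat. Qed.

Let ltuv n : u n < v n.
Proof.
rewrite (@lt_le_trans _ _ 1)//; last by rewrite ler1n.
by rewrite invf_lt1 ?ltr1n// ltr0n.
Qed.

Let ucvg : u n @[n --> \oo] --> (0 : R).
Proof. by have := @cvg_harmonic R; rewrite -cvg_shiftS. Qed.

Let exhD : \bigcup_n `[u n, v n]%classic = D.
Proof.
apply/seteqP; split=> t /=.
  move=> [n _] /=; rewrite !in_itv/= andbT => /andP[+ _].
  by apply: lt_le_trans; rewrite invr_gt0 ltr0n.
rewrite in_itv/= andbT => t0.
have hu : \forall n \near \oo, u n <= t by exact: (cvgr_le _ ucvg).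
have hv := nbhs_infty_ger t.
have [n _ /(_ n (leqnn n)) [h1 h2]] := filterI hu hv.
exists n => //=; rewrite in_itv/= h1/= (le_trans h2)//.
by rewrite /v ler_nat.
Qed.

Definition gamma_integrand (k t : R) : R := expR (- t) * t `^ (k - 1).

Lemma gamma_integrand_ge0 (k t : R) : 0 <= gamma_integrand k t.
Proof. by rewrite mulr_ge0 ?expR_ge0 ?powR_ge0. Qed.

Lemma gamma_integrand_continuous (k t : R) : D t -> {for t, continuous (gamma_integrand k)}.
Proof.
rewrite /= in_itv/= andbT => t0; apply: cvgM; last exact: powR_continuous.
apply: (@continuous_comp _ _ _ (@GRing.opp R) expR t); first exact: oppr_continuous.
exact: continuous_expR.
Qed.

(** This is t / (1 + t), in a form with a single occurrence of t. *)
Let w (t : R) : R := 1 - (1 + t)^-1.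

Let w_gt0 (t : R) : 0 < t -> 0 < w t.
Proof. by move=> t0; rewrite subr_gt0 invf_lt1//; lra. Qed.

Let is_derive_w (t : R) : 0 < t -> is_derive t 1 w ((1 + t) ^- 2).
Proof.
move=> t0; have t1 : 1 + t != 0 by rewrite gt_eqF//; lra.
have d1 : is_derive t 1 ((fun t => 1 + t) : R -> R) 1.
  by apply: is_derive_eq; rewrite add0r mulr1.
have dV := @is_deriveV R (fun t => 1 + t) t 1 1 t1 d1.
have := is_deriveB (is_derive_cst (1 : R) t 1) dV.
by rewrite /GRing.scale/= mulr1 sub0r opprK.
Qed.

Let is_derive_w_powR (k t : R) : 0 < t ->
  is_derive t 1 (fun t => w t `^ k) (k * w t `^ (k - 1) * (1 + t) ^- 2).
Proof.
move=> t0.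
exact: (@is_derive1_comp R (@powR R ^~ k) w t _ _
  (is_derive1_powR k (w_gt0 _ t0)) (is_derive_w _ t0)).
Qed.

(** The derivative of (t / (1 + t))^k dominates the integrand up to a constant:
    it behaves as t^(k - 1) near 0 and as t^(-2) near infinity, and its integral
    over the half-line is 1. One explicit primitive thus controls both ends. *)
Lemma integrable_gamma_integrand (k : R) : 0 < k ->
  mu.-integrable D (EFin \o gamma_integrand k).
Proof.
move=> k0.
pose g t : R := k * w t `^ (k - 1) * (1 + t) ^- 2.
have g0 t : D t -> 0 <= g t.
  rewrite /= in_itv/= andbT => t0.
  by rewrite mulr_ge0 ?invr_ge0 ?exprn_ge0 ?addr_ge0 ?ler01 ?(ltW t0)// mulr_ge0 ?powR_ge0// ltW.
have dF t : D t -> is_derive t 1 (fun t => w t `^ k) (g t).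
  by rewrite /= in_itv/= andbT => t0; exact: is_derive_w_powR.
have cg t : D t -> {for t, continuous g}.
  rewrite /= in_itv/= andbT => t0; apply: cvgM.
    apply: cvgM; first exact: cvg_cst.
    apply: (@continuous_comp _ _ _ w (@powR R ^~ (k - 1)) t).
      exact: is_derive_continuous (is_derive_w _ t0).
    exact: powR_continuous (w_gt0 _ t0).
  apply: cvgV; first by rewrite expf_neq0// gt_eqF//; lra.
  have c1 : (1 + x : R) @[x --> t] --> 1 + t.
    by apply: cvgD; [exact: cvg_cst|exact: cvg_id].
  exact: (cvgM c1 c1).
have Fu : w (u n) `^ k @[n --> \oo] --> (0 : R).
  apply: ((cvg_at_rightP _ _ _).1 (powR_cvg0 k0) (fun n => w (u n))); split.
    by move=> n; apply: w_gt0; rewrite invr_gt0 ltr0n.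
  rewrite -[X in _ --> X](_ : 1 - (1 + 0)^-1 = _); last by rewrite addr0 invr1 subrr.
  apply: cvgB; first exact: cvg_cst.
  apply: cvgV; first by rewrite addr0 oner_neq0.
  by apply: cvgD => //; exact: cvg_cst.
have Fv : w (v n) `^ k @[n --> \oo] --> (1 : R).
  rewrite -[X in _ --> X](_ : 1 `^ k = _); last by rewrite powR1.
  have wv : w (v n) @[n --> \oo] --> (1 : R).
    rewrite -[X in _ --> X](subr0 1); apply: cvgB; first exact: cvg_cst.
    have uE n : (1 + v n)^-1 = u n by rewrite /v /u /harmonic nat1r.
    by under eq_cvg do rewrite uE.
  exact: (cvg_comp _ _ wv (powR_continuous k _ ltr01)).
have intg := ge0_improper_FTC _ _ _ udec vinc ltuv exhD _ _ _ _ g0 dF cg Fu Fv.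
have ig : mu.-integrable D (EFin \o g).
  by apply: (integrable_exhaustion _ _ _ exhD _ cg g0); rewrite intg ltry.
have mD : measurable D by [].
(* C comes from (1 + t)^(k + 1) <= (k + 1)^(k + 1) * exp t and the factor k of g. *)
pose C := (k + 1) `^ (k + 1) / k.
have iCg : mu.-integrable D (fun t => C%:E * (g t)%:E)%E by exact: integrableZl.
apply: (le_integrable _ _ _ iCg) => //.
  apply/measurable_EFinP; apply: (measurable_fun_exhaustion _ _ _ exhD).
  exact: gamma_integrand_continuous.
move=> t Dt /=; have := Dt; rewrite /= in_itv/= andbT => t0.
rewrite lee_fin !ger0_norm ?gamma_integrand_ge0//; last first.
  by rewrite mulr_ge0 ?g0// divr_ge0 ?powR_ge0// ltW.
have t1 : 0 < 1 + t by lra.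
have tE : t = w t * (1 + t) by rewrite /w mulrBl mulVf ?gt_eqF// mul1r [1 + t]addrC addrK.
rewrite /gamma_integrand {2}tE powRM ?(ltW (w_gt0 _ t0)) ?(ltW t1)//.
rewrite (_ : C * g t = w t `^ (k - 1) * ((k + 1) `^ (k + 1) * (1 + t) ^- 2)); last first.
  by rewrite /C /g; field; rewrite !gt_eqF.
rewrite mulrCA ler_wpM2l ?powR_ge0// ler_pdivlMr ?exprn_gt0//.
rewrite -powR_mulrn ?(ltW t1)// -mulrA -powRD; last by rewrite (gt_eqF t1) implybT.
rewrite (_ : k - 1 + 2%:R = k + 1); last by ring.
rewrite mulrC -ler_pdivlMr ?expR_gt0// expRN invrK.
by apply: powR_le_expR; lra.
Qed.

Lemma cvg_Rintegral_gamma (k : R) : 0 < k ->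
  \int[mu]_(t in `[u n, v n]) gamma_integrand k t @[n --> \oo] --> Gamma k.
Proof.
move=> k0; apply: fine_cvg; rewrite fineK; last first.
  exact: integrable_fin_num (integrable_gamma_integrand _ k0).
apply: (cvg_integral_exhaustion _ _ _ udec vinc exhD).
- exact: gamma_integrand_continuous.
- by move=> t _; exact: gamma_integrand_ge0.
Qed.

(** On one segment the integrand is bounded below by its minimum, which is
    positive. *)
Lemma Gamma_gt0 (k : R) : 0 < k -> 0 < Gamma k.
Proof.
move=> k0.
have cE : {within `[u 0%N, v 0%N], continuous (gamma_integrand k)}.
  by apply: (continuous_exhaustion _ _ _ exhD); exact: gamma_integrand_continuous.
have [c cuv cmin] := EVT_min (ltW (ltuv 0)) cE.
have gc0 : 0 < gamma_integrand k c.
  have := sub_exhaustion _ _ _ exhD _ _ cuv; rewrite /= in_itv/= andbT => c0.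
  by rewrite mulr_gt0 ?expR_gt0 ?powR_gt0.
have ig := integrable_gamma_integrand _ k0.
rewrite -lte_fin /Gamma /Rintegral fineK; last exact: integrable_fin_num ig.
have := (integrableP _ _ _ ig).1 => mg.
have sD : `[u 0%N, v 0%N] `<=` D.
  by move=> t; exact: (sub_exhaustion _ _ _ exhD).
apply: (@lt_le_trans _ _ (\int[mu]_(t in `[u 0%N, v 0%N]) (gamma_integrand k t)%:E)%E); last first.
  by apply: ge0_subset_integral => // t _; rewrite lee_fin gamma_integrand_ge0.
apply: (@lt_le_trans _ _ (\int[mu]_(t in `[u 0%N, v 0%N]) (gamma_integrand k c)%:E)%E).
  rewrite integral_cst//= lebesgue_measure_itv/= lte_fin ltuv -EFinB -EFinM lte_fin.
  by rewrite mulr_gt0// subr_gt0.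
apply: ge0_le_integral => //.
- by move=> t _; rewrite lee_fin ltW.
- exact: measurable_funS mg.
Qed.

(** The boundary term of the integration by parts. *)
Let gamma_bnd (k t : R) := expR (- t) * t `^ k.

Let is_derive_gamma_bnd (k t : R) : 0 < t ->
  is_derive t 1 (gamma_bnd k) (k * gamma_integrand k t - gamma_integrand (k + 1) t).
Proof.
move=> t0.
have dE : is_derive t 1 ((fun t => expR (- t)) : R -> R) (- expR (- t)).
  have := @is_derive1_comp R expR (@GRing.opp R) t _ _ (is_derive_expR (- t)) (is_deriveNid t 1).
  by rewrite mulrN1.
have dM : is_derive t 1 (gamma_bnd k) _ := is_deriveM dE (is_derive1_powR k t0).
apply: (is_derive_eq dM).
rewrite /GRing.scale/= /gamma_integrand addrK; ring.
Qed.

Let gamma_bnd_u (k : R) : 0 < k -> gamma_bnd k (u n) @[n --> \oo] --> (0 : R).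
Proof.
move=> k0; rewrite -[X in _ --> X](mulr0 (expR (- 0))); apply: cvgM.
  apply: (cvg_comp u (fun t => expR (- t)) ucvg).
  apply: (@continuous_comp _ _ _ (@GRing.opp R) expR 0); first exact: oppr_continuous.
  exact: continuous_expR.
apply: ((cvg_at_rightP _ _ _).1 (powR_cvg0 k0) u); split => //.
by move=> n; rewrite invr_gt0 ltr0n.
Qed.

Let gamma_bnd_v (k : R) : 0 < k -> gamma_bnd k (v n) @[n --> \oo] --> (0 : R).
Proof.
move=> k0; set C := (k + 1) `^ (k + 1).
(* (1 + v n)^(k + 1) <= C * exp (v n), and 1 / (1 + v n) = u n *)
apply: (@squeeze_cvgr _ _ _ _ (fun=> 0) (fun n => C * u n)).
- apply: nearW => n; rewrite mulr_ge0 ?expR_ge0 ?powR_ge0//=.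
  have v0 : 0 <= v n by rewrite ler0n.
  have v1 : 0 < 1 + v n by lra.
  have -> : u n = (1 + v n)^-1 by rewrite /u /v /harmonic nat1r.
  rewrite ler_pdivlMr//.
  apply: (@le_trans _ _ (expR (- v n) * (1 + v n) `^ (k + 1))).
    rewrite -mulrA ler_wpM2l ?expR_ge0// powRD; last by rewrite (gt_eqF v1) implybT.
    rewrite powRr1 ?(ltW v1)// ler_wpM2r ?(ltW v1)//.
    by apply: ge0_ler_powR; rewrite ?nnegrE//; lra.
  rewrite expRN mulrC ler_pdivrMr ?expR_gt0//.
  by apply: powR_le_expR => //; lra.
- exact: cvg_cst.
- by rewrite -[X in _ --> X](mulr0 C); apply: cvgM; [exact: cvg_cst|].
Qed.

(** On each segment the derivative of t^k * exp (- t) integrates to its boundary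
    values, which vanish in the limit at both ends of the half-line. *)
Lemma GammaS (k : R) : 0 < k -> Gamma (k + 1) = k * Gamma k.
Proof.
move=> k0; have k10 : 0 < k + 1 by lra.
have iu n l : 0 < l -> mu.-integrable `[u n, v n] (EFin \o gamma_integrand l).
  move=> l0; apply: integrableS (integrable_gamma_integrand _ l0) => //.
  by move=> t; exact: (sub_exhaustion _ _ _ exhD).
have E n : k * \int[mu]_(t in `[u n, v n]) gamma_integrand k t
    - \int[mu]_(t in `[u n, v n]) gamma_integrand (k + 1) t
    = gamma_bnd k (v n) - gamma_bnd k (u n).
  rewrite -RintegralZl//; last exact: iu.
  rewrite -RintegralB//; [|exact: (integrableZl _ _ (iu n k k0))|exact: iu].
  have dF t : D t ->
      is_derive t 1 (gamma_bnd k) (k * gamma_integrand k t - gamma_integrand (k + 1) t).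
    by rewrite /= in_itv/= andbT; exact: is_derive_gamma_bnd.
  have cg t : D t ->
      {for t, continuous (fun t => k * gamma_integrand k t - gamma_integrand (k + 1) t)}.
    move=> Dt; apply: cvgB; last exact: gamma_integrand_continuous.
    by apply: cvgM; [exact: cvg_cst|exact: gamma_integrand_continuous].
  by rewrite /Rintegral (integral_exhaustion_FTC _ _ _ ltuv exhD n _ _ dF cg).
have L : gamma_bnd k (v n) - gamma_bnd k (u n) @[n --> \oo] --> k * Gamma k - Gamma (k + 1).
  under eq_cvg do rewrite -E.
  apply: cvgB; last exact: cvg_Rintegral_gamma.
  by apply: cvgM; [exact: cvg_cst|exact: cvg_Rintegral_gamma].
have Z : gamma_bnd k (v n) - gamma_bnd k (u n) @[n --> \oo] --> (0 : R).
  rewrite -[X in _ --> X](subr0 0).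
  by apply: cvgB; [exact: gamma_bnd_v | exact: gamma_bnd_u].
have /eqP : k * Gamma k - Gamma (k + 1) = 0 by exact: (cvg_unique _ L Z).
by rewrite subr_eq0 => /eqP <-.
Qed.

End GammaRecurrence.

(** * Lipschitz bound from the derivative bound *)

Section MeanValue.
Context {R : realType}.
Variables (a b : R) (f f' : R -> R) (M : R).
Hypotheses (hab : a < b) (hf : is_derivative_on a b f f').
Hypothesis hM : forall x : R, x \in `[a, b] -> `|f' x| <= M.

(** At an endpoint, the increment of f is the product of the increment of the
    variable, which tends to 0, and the difference quotient, which converges. *)
Lemma is_derivative_on_continuous : {within `[a, b], continuous f}.
Proof.
have [df dfa dfb] := hf.
apply/(continuous_within_itvP _ hab); split.
- by move=> t /df; exact: is_derive_continuous.
- apply/cvg_at_rightP => u [ua uc].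
  pose h n := u n - a.
  have h0 n : 0 < h n by rewrite subr_gt0.
  have hc : h n @[n --> \oo] --> (0 : R).
    by rewrite -(subrr a); apply: cvgB => //; exact: cvg_cst.
  have uE n : f (u n) = f a + h n * ((h n)^-1 * (f (a + h n) - f a)).
    by rewrite mulrA divff ?gt_eqF// mul1r /h addrC subrK [a + _]addrC subrK.
  have lim : f a + h n * ((h n)^-1 * (f (a + h n) - f a)) @[n --> \oo] --> f a + 0 * f' a.
    apply: cvgD; first exact: cvg_cst.
    by apply: cvgM => //; exact: ((cvg_at_rightP _ _ _).1 dfa h).
  by rewrite mul0r addr0 in lim; under eq_cvg do rewrite uE.
- apply/cvg_at_leftP => u [ub uc].
  pose h n := u n - b.
  have h0 n : h n < 0 by rewrite subr_lt0.
  have hc : h n @[n --> \oo] --> (0 : R).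
    by rewrite -(subrr b); apply: cvgB => //; exact: cvg_cst.
  have uE n : f (u n) = f b + h n * ((h n)^-1 * (f (b + h n) - f b)).
    by rewrite mulrA divff ?lt_eqF// mul1r /h addrC subrK [b + _]addrC subrK.
  have lim : f b + h n * ((h n)^-1 * (f (b + h n) - f b)) @[n --> \oo] --> f b + 0 * f' b.
    apply: cvgD; first exact: cvg_cst.
    by apply: cvgM => //; exact: ((cvg_at_leftP _ _ _).1 dfb h).
  by rewrite mul0r addr0 in lim; under eq_cvg do rewrite uE.
Qed.

Lemma is_derivative_on_lipschitz (x y : R) : x \in `[a, b] -> y \in `[a, b] -> x <= y ->
  `|f y - f x| <= M * (y - x).
Proof.
rewrite !in_itv/= => /andP[ax xb] /andP[ay yb] xy.
have [df _ _] := hf.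
have dfxy t : t \in `]x, y[ -> is_derive t 1 f (f' t).
  rewrite in_itv/= => /andP[xt ty]; apply: df; rewrite in_itv/=.
  by rewrite (le_lt_trans ax)// (lt_le_trans ty).
have cfxy : {within `[x, y], continuous f}.
  apply: continuous_subspaceW is_derivative_on_continuous.
  by apply: subset_itv; rewrite bnd_simp.
have [c cxy fE] := MVT_segment xy dfxy cfxy.
rewrite fE normrM [`|y - x|]ger0_norm ?subr_ge0// ler_wpM2r ?subr_ge0//.
apply: hM; move: cxy; rewrite !in_itv/= => /andP[xc cy].
by rewrite (le_trans ax)// (le_trans cy).
Qed.

End MeanValue.

(** * Deviation of weighted means of a Lipschitz function *)

Section WeightedMean.
Context {R : realType}.
Notation mu := (@lebesgue_measure R).

(** The integrability of w * f, for a possibly unbounded w, is derived from that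
    of w and w * delta through w * f = A * w - w * (A - f). *)
Lemma weighted_deviation (c d M A : R) (f w delta : R -> R) :
  measurable_fun `[c, d] f ->
  (forall t, t \in `[c, d] -> 0 <= w t) ->
  mu.-integrable `[c, d] (EFin \o w) ->
  mu.-integrable `[c, d] (EFin \o (fun t => w t * delta t)) ->
  (forall t, t \in `[c, d] -> `|A - f t| <= M * delta t) ->
  `|A * \int[mu]_(t in `[c, d]) w t - \int[mu]_(t in `[c, d]) (w t * f t)|
    <= M * \int[mu]_(t in `[c, d]) (w t * delta t).
Proof.
move=> mf w0 iw iwd fd.
have mw : measurable_fun `[c, d] w by case/integrableP : iw => /measurable_EFinP.
have iAw : mu.-integrable `[c, d] (EFin \o (fun t => A * w t)).
  by apply: (integrableZl _ A iw).
have iMwd : mu.-integrable `[c, d] (EFin \o (fun t => M * (w t * delta t))).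
  by apply: (integrableZl _ M iwd).
have le_dev t : t \in `[c, d] -> `|w t * (A - f t)| <= M * (w t * delta t).
  move=> tcd; rewrite normrM ger0_norm ?w0// mulrCA.
  by rewrite ler_wpM2l ?w0// fd.
have idev : mu.-integrable `[c, d] (EFin \o (fun t => w t * (A - f t))).
  apply: (le_integrable _ _ _ iMwd) => //.
    apply/measurable_EFinP; apply: measurable_funM => //.
    by apply: measurable_funB.
  move=> t tcd /=; rewrite lee_fin (le_trans (le_dev _ tcd))//.
  exact: ler_norm.
have iwf : mu.-integrable `[c, d] (EFin \o (fun t => w t * f t)).
  apply: (eq_integrable _ _ _ _ (integrableB _ iAw idev)) => // t _ /=.
  by rewrite -EFinB; congr EFin; ring.
have idif : mu.-integrable `[c, d] (EFin \o (fun t => A * w t - w t * f t)).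
  by apply: (eq_integrable _ _ _ _ idev) => // t _ /=; congr EFin; ring.
rewrite -RintegralZl// -RintegralB// -RintegralZl//.
apply: (le_trans (le_normr_Rintegral _ idif)) => //.
apply: le_Rintegral => //; first exact: (integrable_norm idif).
move=> t tcd /=; rewrite (_ : A * w t - w t * f t = w t * (A - f t)); last by ring.
exact: le_dev.
Qed.

(** Here r is the distance to the endpoint where the kernel may be singular, so
    d - c - r is the distance to the other endpoint, where f takes the value A;
    r t = t - c and r t = d - t give the two kernels. Since
    r^(k - 1) * (d - c - r) = (d - c) * r^(k - 1) - r^k, the moments of orders k
    and k + 1 give the constant, as k * (1 / k - 1 / (k + 1)) = 1 / (k + 1). *)
Lemma power_kernel_deviation (c d M A k : R) (f r : R -> R) : c <= d -> 0 < k ->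
  (forall t, t \in `[c, d] -> 0 <= r t) ->
  (forall l, 0 < l -> mu.-integrable `[c, d] (EFin \o (fun t => r t `^ (l - 1))) /\
    \int[mu]_(t in `[c, d]) r t `^ (l - 1) = (d - c) `^ l / l) ->
  measurable_fun `[c, d] f ->
  (forall t, t \in `[c, d] -> `|A - f t| <= M * (d - c - r t)) ->
  `|(d - c) `^ k * A - k * \int[mu]_(t in `[c, d]) (r t `^ (k - 1) * f t)|
    <= M * ((d - c) `^ (k + 1) / (k + 1)).
Proof.
move=> cd k0 r0 moments mf fd.
have k10 : 0 < k + 1 by lra.
have [iw Iw] := moments _ k0; have [iw1 Iw1] := moments _ k10.
have wdE t : t \in `[c, d] ->
    r t `^ (k - 1) * (d - c - r t) = (d - c) * r t `^ (k - 1) - r t `^ (k + 1 - 1).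
  by move=> /r0 rt; rewrite addrK -(@mulr_powRB1 _ (r t) k)//; ring.
have iw' : mu.-integrable `[c, d] (EFin \o (fun t => (d - c) * r t `^ (k - 1))).
  by apply: (integrableZl _ (d - c) iw).
have iwd : mu.-integrable `[c, d] (EFin \o (fun t => r t `^ (k - 1) * (d - c - r t))).
  apply: (eq_integrable _ _ _ _ (integrableB _ iw' iw1)) => // t.
  by rewrite inE => /wdE /= ->; rewrite -EFinB.
have Iwd : \int[mu]_(t in `[c, d]) (r t `^ (k - 1) * (d - c - r t))
    = k^-1 * ((d - c) `^ (k + 1) / (k + 1)).
  transitivity (\int[mu]_(t in `[c, d]) ((d - c) * r t `^ (k - 1) - r t `^ (k + 1 - 1))).
    by apply: eq_Rintegral => t; rewrite inE => /wdE.
  rewrite RintegralB// RintegralZl// Iw Iw1.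
  rewrite -(@mulr_powRB1 _ (d - c) (k + 1)) ?subr_ge0// addrK; field.
  by rewrite !gt_eqF.
have w0 t : t \in `[c, d] -> 0 <= r t `^ (k - 1) by rewrite powR_ge0.
have := weighted_deviation _ _ _ _ _ _ _ mf w0 iw iwd fd.
rewrite Iw Iwd => dev.
rewrite (_ : (d - c) `^ k * A - _ =
  k * (A * ((d - c) `^ k / k) - \int[mu]_(t in `[c, d]) (r t `^ (k - 1) * f t))); last first.
  by field; rewrite gt_eqF.
by rewrite normrM (gtr0_norm k0) -ler_pdivlMl// [leRHS]mulrCA.
Qed.

End WeightedMean.

(** * Comparison of the constants *)

Section Constants.
Context {R : realType}.

(** For finite p, Young's inequality applied to (1 + alpha) * 1 reads
    1 + alpha <= (1 + alpha)^p / p + 1 / q, and 1 / q = 1 - 1 / p rearranges it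
    into 1 + p * alpha <= (1 + alpha)^p. *)
Lemma conj_factor_gt0_le (p : \bar R) (q alpha : R) : 1 <= q ->
  (p^-1 + (q%:E)^-1 = 1)%E -> 0 < alpha -> 0 < conj_factor p alpha <= 1 + alpha.
Proof.
move=> q1 + alpha0; have q0 : 0 < q by lra.
case: p => [r| |] /=; last 2 first.
- by move=> _; rewrite ltr01/=; lra.
- by move=> _; rewrite ltr01/=; lra.
rewrite !inver (gt_eqF q0); case: ifPn => // r_neq0.
rewrite -EFinD => /(congr1 fine) /= pq.
have qV1 : q^-1 <= 1 by rewrite invf_le1.
have qV0 : 0 < q^-1 by rewrite invr_gt0.
have rV0 : 0 <= r^-1 by lra.
have r0 : 0 < r by rewrite lt_def r_neq0 -invr_ge0.
have ra0 : 0 < r * alpha by rewrite mulr_gt0.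
rewrite powR_gt0 ?addr_gt0//=.
have young := conjugate_powR (ltW (addr_gt0 (@ltr01 R) alpha0)) (@ler01 R) r0 q0 pq.
have bern : 1 + r * alpha <= (1 + alpha) `^ r.
  move: young; rewrite powR1 mulr1 mul1r -lerBlDr ler_pdivlMr//.
  rewrite (_ : (1 + alpha - q^-1) * r = 1 + r * alpha)//.
  by rewrite (_ : q^-1 = 1 - r^-1); [field | lra].
apply: (@le_trans _ _ (((1 + alpha) `^ r) `^ r^-1)).
  by apply: ge0_ler_powR; rewrite ?nnegrE ?powR_ge0//; lra.
by rewrite -powRrM divff// powRr1//; lra.
Qed.

Lemma convexity_factor_ge1 (s q : R) : 0 < s <= 1 -> 0 <= q ->
  1 <= (2 / (s + 1)) `^ q^-1.
Proof.
move=> /andP[s0 s1] q0; rewrite -[leLHS](powRr0 (2 / (s + 1))).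
apply: ler_powR; last by rewrite invr_ge0.
by rewrite ler_pdivlMr; lra.
Qed.

End Constants.

Theorem theorem9 (R : realType) (a b : R) (f f' : R -> R) (q s M : R)
    (p : \bar R)
    (ha : 0 <= a) (hab : a < b)
    (hf : is_derivative_on a b f f')
    (hint : (@lebesgue_measure R).-integrable `[a, b] (EFin \o f'))
    (hq : 1 <= q)
    (hpq : (p^-1 + (q%:E)^-1 = 1)%E)
    (hs : 0 < s <= 1)
    (hconv : s_convex s `[a, b] (fun x => `|f' x| `^ q))
    (hM : forall x : R, x \in `[a, b] -> `|f' x| <= M) :
  forall alpha x : R, 0 < alpha -> x \in `[a, b] ->
    `| ((x - a) `^ alpha + (b - x) `^ alpha) / (b - a) * f x
       - Gamma (alpha + 1) / (b - a)
         * (RL_minus alpha x f a + RL_plus alpha x f b) |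
    <= M / conj_factor p alpha * (2 / (s + 1)) `^ q^-1
       * (((x - a) `^ (alpha + 1) + (b - x) `^ (alpha + 1)) / (b - a)).
Proof.
move=> alpha x alpha0 xab; have := xab; rewrite in_itv/= => /andP[ax xb].
have ba0 : 0 < b - a by rewrite subr_gt0.
have M0 : 0 <= M by rewrite (le_trans _ (hM a _))// in_itv/= lexx ltW.
have mf : measurable_fun `[a, b] f.
  apply: subspace_continuous_measurable_fun => //.
  exact: is_derivative_on_continuous hab hf.
have lip := is_derivative_on_lipschitz _ _ _ _ _ hab hf hM.
have /andP[cf0 cf1] := conj_factor_gt0_le _ _ _ hq hpq alpha0.
have k1 : 1 <= (2 / (s + 1)) `^ q^-1 by apply: convexity_factor_ge1 => //; lra.
have alpha1 : 0 < alpha + 1 by lra.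
have constant_le : M / (alpha + 1) <= M / conj_factor p alpha * (2 / (s + 1)) `^ q^-1.
  rewrite -[leLHS]mulr1 ler_pM ?divr_ge0 ?(ltW alpha1)//.
  by rewrite ler_wpM2l// lef_pV2 ?posrE// [leRHS]addrC.
have left_dev : `|(x - a) `^ alpha * f x
    - alpha * \int[lebesgue_measure]_(t in `[a, x]) ((t - a) `^ (alpha - 1) * f t)|
    <= M * ((x - a) `^ (alpha + 1) / (alpha + 1)).
  apply: (power_kernel_deviation _ _ _ _ _ _ (fun t => t - a)) => //.
  - by move=> t; rewrite in_itv/= subr_ge0 => /andP[].
  - by move=> l l0; exact: powR_left_moment.
  - by apply: measurable_funS mf => //; apply: subset_itvl; rewrite bnd_simp.
  - move=> t; rewrite in_itv/= => /andP[at_ tx]; rewrite opprB addrA subrK.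
    by apply: lip => //; rewrite in_itv/= at_ (le_trans tx).
have right_dev : `|(b - x) `^ alpha * f x
    - alpha * \int[lebesgue_measure]_(t in `[x, b]) ((b - t) `^ (alpha - 1) * f t)|
    <= M * ((b - x) `^ (alpha + 1) / (alpha + 1)).
  apply: (power_kernel_deviation _ _ _ _ _ _ (fun t => b - t)) => //.
  - by move=> t; rewrite in_itv/= subr_ge0 => /andP[].
  - by move=> l l0; exact: powR_right_moment.
  - by apply: measurable_funS mf => //; apply: subset_itvr; rewrite bnd_simp.
  - move=> t; rewrite in_itv/= => /andP[xt tb].
    rewrite (_ : b - x - (b - t) = t - x); last by ring.
    by rewrite distrC; apply: lip => //; rewrite in_itv/= tb andbT (le_trans ax).
have G0 : Gamma alpha != 0 by rewrite gt_eqF// Gamma_gt0.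
rewrite /RL_minus /RL_plus GammaS//.
set I1 := Rintegral _ _ _ in left_dev *; set I2 := Rintegral _ _ _ in right_dev *.
rewrite (_ : _ - _ = (((x - a) `^ alpha * f x - alpha * I1)
   + ((b - x) `^ alpha * f x - alpha * I2)) / (b - a)); last first.
  by field; rewrite G0 gt_eqF.
rewrite normrM (@gtr0_norm _ (b - a)^-1) ?invr_gt0// [leRHS]mulrA.
rewrite ler_wpM2r ?invr_ge0 ?(ltW ba0)// (le_trans (ler_normD _ _))//.
apply: (le_trans (lerD left_dev right_dev)).
rewrite -mulrDr -mulrDl mulrCA mulrC.
by rewrite ler_wpM2r ?addr_ge0 ?powR_ge0.
Qed.
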